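(* For every $\varepsilon>0$ there is a constant $C_\varepsilon>0$ such that for every even positive integer $n$, $$\#s^{-1}(\{n\})=\#\{m\in\mathbb{N} : s(m)=n\}\le C_\varepsilon\, n^{1/2+\varepsilon}.$$
   Context: $\mathbb{N}$ denotes the set of positive integers. For $m\in\mathbb{N}$, $s(m)=\sum_{d\mid m,\ d\neq m} d$ denotes the sum of the proper (positive) divisors of $m$. *)

(* Defs.v *)
From mathcomp Require Import all_boot all_order all_algebra.
From mathcomp Require Import all_classical all_reals all_analysis.

Set Implicit Arguments.
Unset Strict Implicit.
Unset Printing Implicit Defensive.

Local Open Scope nat_scope.
Local Open Scope classical_set_scope.

Definition s (m : nat) : nat := \sum_(d <- divisors m | d != m) d.

(* The domain of s is the set of positive integers, while nat contains 0. *)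
Definition s_fiber (n : nat) : set nat := [set m : nat | 0 < m /\ s m = n].

(* Main.v *)
Require Import Defs.
From mathcomp Require Import all_boot all_order all_algebra finmap zify ring.
From mathcomp Require Import all_classical all_reals all_analysis.
Import Order.TTheory GRing.Theory Num.Theory.

(** Write [sigma m = m + s m] for the sum of all divisors of [m] and [tau m] for
    their number, and let [n] be even and positive. Up to factors of size
    [n `^ eps], which absorb the number of divisors of any integer up to
    [2 * n ^ 2] ([tau_bound]), there are at most [sqrt n] solutions of [s m = n].

    If [m] is odd, then [sigma m = m + n] is odd, which forces [m] to be a square.
    Split off the full power [p ^ v] of its least prime [p]: then
    [m = p ^ v * d ^ 2] with [v >= 2]. Since the proper divisor [m / p] is at
    most [n], so is [d ^ 2]; and [s (p ^ v * d ^ 2)] is strictly increasing in [p],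
    so that the pair [(d, v)] determines [m] ([size_odd_preimages]).

    If [m] is even, then [m / 2 <= s m = n]. Let [D] be an even unitary divisor of
    [m], with cofactor [c], and [a] a divisor of [D]. Two constraints confine [m].

    - Congruence: [a] divides [m] and [sigma D] divides [sigma m = m + n]. This
      fixes [m] modulo [lcmn a (sigma D)], and since a common divisor of [a] and
      [sigma D] must divide [n], this modulus is at least [a * D / gcdn a n].

    - Size: [n = s D * c + sigma D * s c]. If all primes dividing [c] are at least
      [y], then [s c <= tau c * c / y], so [c] is known up to a relative
      error [O(tau c / y)], and [m] lies in an interval of length
      [O(n * tau c / y)].

    So there are about [1 + n * gcdn a n / (a * D * y)] such [m]
    ([size_unitary_rough]). If [m] is at most [N], about [sqrt n], choose [D = a = m].
    Otherwise multiply the prime power components of [m] in increasing order of the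
    primes until [N] is exceeded ([exists_unitary_rough]). With [a <= N] the last
    product before that and [z] the next prime, either [a * z > N], and [D = a]
    with [y = z > N / a] works; or [D = a * z ^ v > N] with [y = z] works. Setting [p = 1] in the first case and
    [p = z] in the second, there are in both cases at most about
    [N * gcdn a n / (a * p)] preimages for given [a], [p] and [v]. The sum of
    [gcdn a n / a] over [a <= N] is at most the number of divisors of [n]
    times a harmonic sum, and so the total is [N] up to divisor-bound factors
    ([size_even_preimages]). *)

Set Implicit Arguments.
Unset Strict Implicit.
Unset Printing Implicit Defensive.

Local Open Scope nat_scope.

(** * Divisor sums and divisor counts *)

Definition sigma (m : nat) : nat := \sum_(d <- divisors m) d.

Definition tau (m : nat) : nat := size (divisors m).

Lemma perm_divisorsM m n : 0 < m -> 0 < n -> coprime m n ->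
  perm_eq (divisors (m * n)) [seq x * y | x <- divisors m, y <- divisors n].
Proof.
move=> m0 n0 cmn; have mn0 : 0 < m * n by rewrite muln_gt0 m0.
apply: uniq_perm; first exact: divisors_uniq.
  apply: allpairs_uniq; rewrite ?divisors_uniq // => -[x y] [x' y'] /=.
  move=> /allpairsP[[u v] /= [um vn [-> ->]]].
  move=> /allpairsP[[u' v'] /= [um' vn' [-> ->]]].
  move: um vn um' vn'; rewrite -!dvdn_divisors // => um vn um' vn' e.
  (* the left factor of a divisor d of m * n is recovered as gcdn m d *)
  have G w z : w %| m -> z %| n -> gcdn m (w * z) = w.
    by move=> wm zn; rewrite Gauss_gcdl ?(coprime_dvdr zn) //; apply/gcdn_idPr.
  have eu : u = u' by rewrite -(G u v) // e G.
  move: e; rewrite eu => /eqP; rewrite eqn_pmul2l; first by move/eqP ->.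
  exact: dvdn_gt0 um'.
move=> d; rewrite -dvdn_divisors //; apply/idP/allpairsP => [dmn | [[u v] /= []]].
  exists (gcdn d m, gcdn d n); rewrite /= -!dvdn_divisors // !dvdn_gcdr.
  split=> //; apply/eqP; rewrite eqn_dvd; apply/andP; split.
    by rewrite muln_gcdr dvdn_gcd dvdn_mull //= muln_gcdl dvdn_gcd dvdn_mulr.
  rewrite Gauss_dvd ?dvdn_gcdl //.
  by rewrite (coprime_dvdl (dvdn_gcdr _ _)) // (coprime_dvdr (dvdn_gcdr _ _)).
by rewrite -!dvdn_divisors // => um vn ->; apply: dvdn_mul.
Qed.

Lemma sigmaM m n : 0 < m -> 0 < n -> coprime m n ->
  sigma (m * n) = sigma m * sigma n.
Proof.
move=> m0 n0 cmn; rewrite /sigma (perm_big _ (perm_divisorsM m0 n0 cmn)) /=.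
rewrite big_allpairs_dep /= big_distrl /=.
by apply: eq_bigr => x _; rewrite big_distrr.
Qed.

Lemma tauM m n : 0 < m -> 0 < n -> coprime m n -> tau (m * n) = tau m * tau n.
Proof.
move=> m0 n0 cmn.
by rewrite /tau (perm_size (perm_divisorsM m0 n0 cmn)) size_allpairs.
Qed.

Lemma perm_divisors_pfactor p e : prime p ->
  perm_eq (divisors (p ^ e)) [seq p ^ i | i <- iota 0 e.+1].
Proof.
move=> pp; apply: uniq_perm; first exact: divisors_uniq.
  by rewrite map_inj_uniq ?iota_uniq // => i j; apply: expnI; apply: prime_gt1.
move=> d; rewrite -dvdn_divisors ?expn_gt0 ?prime_gt0 //.
apply/(dvdn_pfactor _ _ pp)/mapP => [[i ie ->] | [i]].
  by exists i; rewrite // mem_iota.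
by rewrite mem_iota ltnS => ie ->; exists i.
Qed.

Lemma tau_pfactor p e : prime p -> tau (p ^ e) = e.+1.
Proof.
move=> pp; rewrite /tau (perm_size (perm_divisors_pfactor e pp)).
by rewrite size_map size_iota.
Qed.

Lemma sigma_pfactor p e : prime p -> sigma (p ^ e) = \sum_(i < e.+1) p ^ i.
Proof.
move=> pp; rewrite /sigma (perm_big _ (perm_divisors_pfactor e pp)) big_map.
by rewrite -(big_mkord predT (fun i => p ^ i)) /index_iota subn0.
Qed.

Lemma sigmaE m : 0 < m -> sigma m = m + s m.
Proof.
move=> m0; rewrite /sigma /s (bigD1_seq m) //= ?divisors_uniq //.
by rewrite -dvdn_divisors.
Qed.

Lemma leq_dvd_s d m : d %| m -> d < m -> d <= s m.
Proof.
move=> dm ltdm; have m0 : 0 < m by apply: leq_ltn_trans ltdm.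
rewrite /s big_mkcond (bigD1_seq d) ?divisors_uniq -?dvdn_divisors //=.
by rewrite neq_ltn ltdm leq_addr.
Qed.

Lemma sigma_gt0 m : 0 < m -> 0 < sigma m.
Proof. by move=> m0; rewrite sigmaE // addn_gt0 m0. Qed.

(** For inductions that strip the prime factors of [m] in increasing order. *)
Lemma pdiv_split m (p := pdiv m) (v := logn p m) (a := m %/ p ^ v) : 1 < m ->
  [/\ m = p ^ v * a, 0 < v, 0 < a, coprime (p ^ v) a &
    forall q, prime q -> q %| a -> p < q].
Proof.
move=> m1; have pp : prime p := pdiv_prime m1; have m0 : 0 < m by apply: ltnW.
have v0 : 0 < v by rewrite logn_gt0 mem_primes pp m0 pdiv_dvd.
have [b cb me] := pfactor_coprime pp m0.
have ab : a = b by rewrite /a {1}me mulnK // expn_gt0 prime_gt0.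
rewrite -/v -ab in me cb; have a0 : 0 < a by move: m0; rewrite me; case: (a).
split; rewrite ?coprimeXl // 1?mulnC //.
move=> q pq qa; rewrite ltn_neqAle; apply/andP; split; last first.
  by apply: pdiv_min_dvd; [exact: prime_gt1 | rewrite me dvdn_mulr].
by apply: contraL cb => /eqP ->; rewrite prime_coprime // qa.
Qed.

(** With [q = v %/ k] one has [v + 1 <= k * (q + 1) <= k * 2 ^ q], and
    [(2 ^ q) ^ k <= 2 ^ v]. *)
Lemma leq_expS_expn2 k v : v.+1 ^ k <= k ^ k * 2 ^ v.
Proof.
have [-> | k0] := posnP k; first by rewrite !expn0 mul1n expn_gt0.
apply: (@leq_trans (k ^ k * (2 ^ (v %/ k)) ^ k)).
  rewrite -expnMn leq_exp2r //.
  apply: leq_trans (leq_mul (leqnn k) (ltn_expl (v %/ k) (isT : 1 < 2))).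
  by rewrite mulnC ltn_ceil.
by rewrite -expnM leq_pmul2l ?expn_gt0 ?k0 // leq_exp2l // leq_divM.
Qed.

(** Divisor bound. A prime [p >= 2 ^ k] contributes to
    [tau n ^ k = \prod_p (v_p + 1) ^ k] at most [2 ^ (k * v_p) <= p ^ v_p],
    while each of the fewer than [2 ^ k] smaller ones costs a constant
    factor [k ^ k]. *)
Lemma tau_bound k : exists2 K, 0 < K & forall n, 0 < n -> tau n ^ k <= K * n.
Proof.
have kk0 : 0 < k ^ k by case: k => // k; rewrite expn_gt0.
exists ((k ^ k) ^ (2 ^ k)); first by rewrite expn_gt0 kk0.
(* [z] bounds the prime factors of [n] from below: [2 ^ k - z] then bounds the
   number of small primes still to come. *)
suff H n z : 0 < n -> (forall q, prime q -> q %| n -> z <= q) ->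
    tau n ^ k <= (k ^ k) ^ (2 ^ k - z) * n.
  by move=> n n0; have := H n 0 n0; rewrite subn0; apply.
elim/ltn_ind: n z => n IH z n0 hz; have [n1 | n1] := leqP n 1.
  have -> : n = 1 by apply/eqP; rewrite eqn_leq n1.
  by rewrite /tau exp1n muln1 expn_gt0 kk0.
have pp := pdiv_prime n1; set p := pdiv n in pp.
have [ne v0 a0 cpa ha] := pdiv_split n1.
rewrite -/p in ne v0 a0 cpa ha; set v := logn p n in ne v0 a0 cpa ha.
set a := n %/ p ^ v in ne a0 cpa ha.
have pv0 : 0 < p ^ v by rewrite expn_gt0 prime_gt0.
have zp : z <= p by apply: hz => //; exact: pdiv_dvd.
have lta : a < n.
  by rewrite ne ltn_Pmull // -(exp1n v) ltn_exp2r // prime_gt1.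
have {IH}IHa := IH a lta p.+1 a0 ha.
rewrite ne tauM // tau_pfactor // expnMn.
have [p2 | p2] := leqP (2 ^ k) p.
  have z0 : 2 ^ k - p.+1 = 0 by apply/eqP; rewrite subn_eq0 leqW.
  rewrite z0 expn0 mul1n in IHa.
  apply: (@leq_trans (p ^ v * a)); last by rewrite leq_pmull // expn_gt0 kk0.
  apply: leq_mul IHa; apply: leq_trans (_ : (2 ^ k) ^ v <= _).
    rewrite -expnM [k * v]mulnC expnM.
    have [-> | k0] := posnP k; first by rewrite !expn0.
    by rewrite leq_exp2r // ltn_expl.
  by rewrite leq_exp2r.
apply: leq_trans (leq_mul (leq_expS_expn2 k v) IHa) _.
rewrite mulnACA; apply: leq_mul; last first.
  by rewrite leq_pmul2r // leq_exp2r ?prime_gt1.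
by rewrite -expnS leq_pexp2l // -subSn // subSS leq_sub2l.
Qed.

(** * Odd preimages of an even number *)

Lemma odd_sigma_pfactor p v : prime p -> odd p -> odd (sigma (p ^ v)) = ~~ odd v.
Proof.
move=> pp op; rewrite sigma_pfactor //; elim: v => [|v IH].
  by rewrite big_ord_recr big_ord0.
by rewrite big_ord_recr /= oddD IH oddX op orbT; case: (odd v).
Qed.

(** For odd [m] the factor [sigma (p ^ v)] is a sum of [v + 1] odd numbers, so
    it is odd only when [v] is even. *)
Lemma odd_sigma_square m : odd m -> odd (sigma m) -> exists k, m = k ^ 2.
Proof.
elim/ltn_ind: m => m IH om; have [m1 _ | m1] := leqP m 1.
  by exists 1; apply/eqP; rewrite eqn_leq m1; case: (m) om.
have [me v0 a0 ca _] := pdiv_split m1.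
have pp := pdiv_prime m1; set p := pdiv m in me v0 a0 ca pp.
set v := logn p m in me v0 a0 ca; set a := m %/ p ^ v in me a0 ca.
have pv0 : 0 < p ^ v by rewrite expn_gt0 prime_gt0.
move: (om); rewrite {1}me oddM oddX eqn0Ngt v0 /= => /andP[op oa].
rewrite me sigmaM // oddM odd_sigma_pfactor // => /andP[ev osa].
have lta : a < m by rewrite me ltn_Pmull // -(exp1n v) ltn_exp2r // prime_gt1.
have [k ak] := IH a lta oa osa; exists (p ^ v./2 * k).
by rewrite expnMn -ak -expnM muln2 -[X in p ^ X * _]odd_double_half (negPf ev).
Qed.

(** [s (p ^ v * a)] expands as [s a * p ^ v + sigma a * (1 + p + ... + p ^ v.-1)],
    a polynomial in [p] with nonnegative coefficients, nonconstant as [v > 1]. *)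
Lemma s_pfactorM_lt a v p q : 0 < a -> 1 < v -> prime p -> prime q ->
  coprime (p ^ v) a -> coprime (q ^ v) a -> p < q -> s (p ^ v * a) < s (q ^ v * a).
Proof.
move=> a0 v1 pp pq cp cq ltpq.
have E r : prime r -> coprime (r ^ v) a ->
    s (r ^ v * a) = s a * r ^ v + sigma a * \sum_(i < v) r ^ i.
  move=> pr cr; have r0 : 0 < r ^ v by rewrite expn_gt0 prime_gt0.
  apply/eqP; rewrite -(eqn_add2l (r ^ v * a)) -sigmaE ?muln_gt0 ?r0 // sigmaM //.
  rewrite sigma_pfactor // big_ord_recr /= sigmaE //; apply/eqP; ring.
rewrite !E // -addnS; apply: leq_add.
  by rewrite leq_mul // leq_exp2r // ltnW // ltnW.
rewrite ltn_pmul2l ?sigma_gt0 //; case: v v1 {E cp cq} => [|[|v]] // _.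
rewrite !big_ord_recl /= ltn_add2l -addSn; apply: leq_add; first by [].
by apply: leq_sum => i _; rewrite leq_exp2r // ltnW.
Qed.

Lemma odd_s_gt0_gt1 m : odd m -> 0 < s m -> 1 < m.
Proof. by case: m => [|[|m]] //; rewrite /s big_cons big_nil. Qed.


Section OddPreimages.

Variables (n N T : nat).
Hypotheses (n0 : 0 < n) (en : ~~ odd n) (leN : n <= N ^ 2).
Hypothesis taule : forall k, 0 < k -> k <= 2 * n ^ 2 -> tau k <= T.

(** An odd preimage [m] of the even number [n] has [sigma m] odd, so
    [m = p ^ v * a] with [v] even and [a] a square. The proper divisor
    [m / p = p ^ (v - 1) * a] is at most [n], whence [p * a <= n] and
    [m <= n * p <= n ^ 2]. *)
Lemma odd_preimage_split m (p := pdiv m) (v := logn p m) (a := m %/ p ^ v) :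
  odd m -> s m = n ->
  [/\ m <= n ^ 2, 1 < v, v < T & exists2 d, d < N.+1 & a = d ^ 2].
Proof.
move=> om sm.
have m1 : 1 < m by rewrite odd_s_gt0_gt1 ?sm.
have [me v0 a0 ca _] := pdiv_split m1; have pp : prime p := pdiv_prime m1.
rewrite -/p -/v -/a in me v0 a0 ca; have m0 := ltnW m1.
have pv0 : 0 < p ^ v by rewrite expn_gt0 prime_gt0.
move: (om); rewrite {1}me oddM oddX eqn0Ngt v0 /= => /andP[op oa].
have: odd (sigma m) by rewrite sigmaE // oddD om sm (negPf en).
rewrite {1}me sigmaM // oddM odd_sigma_pfactor // => /andP[ev osa].
have [d ad] := odd_sigma_square oa osa.
have v1 : 1 < v by case: (v) v0 ev => [|[|]].
(* [p ^ v.-1 * a] is a proper divisor of [m], and [v.-1 > 0]. *)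
have pa : p * a <= n.
  have p0 := prime_gt0 pp; rewrite -sm.
  have le1 : p * a <= p ^ v.-1 * a.
    by rewrite leq_mul // -{1}(expn1 p) leq_pexp2l //; case: (v) v1 => [|[|]].
  apply: leq_trans le1 _; apply: leq_dvd_s.
    by rewrite [m in _ %| m]me dvdn_pmul2r // dvdn_exp2l // leq_pred.
  by rewrite [m in _ < m]me ltn_pmul2r // ltn_exp2l ?prime_gt1 // prednK.
have mpn : m <= n * p.
  have := leq_dvd_s (_ : m %/ p %| m) (_ : m %/ p < m).
  rewrite sm dvdn_div ?pdiv_dvd // ltn_Pdiv ?prime_gt1 // => /(_ isT isT) H.
  by rewrite -(divnK (pdiv_dvd m)) leq_mul2r H orbT.
have pn : p <= n by apply: leq_trans pa; rewrite leq_pmulr.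
have mn : m <= n ^ 2 by apply: leq_trans mpn _; rewrite leq_mul.
split=> //.
  rewrite -(tau_pfactor v pp); apply: taule => //.
  apply: leq_trans (leq_trans mn (leq_pmull _ _)) => //.
  by rewrite [m in _ <= m]me leq_pmulr.
exists d => //; rewrite ltnS -(leq_exp2r _ _ (isT : 0 < 2)) -ad.
by apply: leq_trans leN; apply: leq_trans pa; rewrite leq_pmull // prime_gt0.
Qed.

(** Every odd preimage is [p ^ v * d ^ 2] with [d <= N] and [v < T], and the pair
    [(d, v)] determines it because [s (p ^ v * d ^ 2)] increases with [p]. *)
Lemma size_odd_preimages (F : seq nat) : uniq F ->
  (forall m, m \in F -> odd m /\ s m = n) -> size F <= N.+1 * T.
Proof.
move=> uF hF; pose f m := (m %/ pdiv m ^ logn (pdiv m) m, logn (pdiv m) m).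
rewrite -(size_map f).
have -> : N.+1 * T = size [seq (d ^ 2, v) | d <- iota 0 N.+1, v <- iota 0 T].
  by rewrite size_allpairs !size_iota.
apply: uniq_leq_size => [|[b w] /mapP[m mF [-> ->]]].
  rewrite map_inj_in_uniq // => m m' /hF[om sm] /hF[om' sm'] [ea ev].
  have [_ v1 _ _] := odd_preimage_split om sm.
  have m1 : 1 < m by rewrite odd_s_gt0_gt1 ?sm.
  have m1' : 1 < m' by rewrite odd_s_gt0_gt1 ?sm'.
  have [me _ a0 ca _] := pdiv_split m1; have [me' _ _ ca' _] := pdiv_split m1'.
  have pp := pdiv_prime m1; have pp' := pdiv_prime m1'.
  move: me' ca'; rewrite -ea -ev => me' ca'.
  have [lt | lt | e] := ltngtP (pdiv m) (pdiv m'); last by rewrite me me' e.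
    by have := s_pfactorM_lt a0 v1 pp pp' ca ca' lt; rewrite -me -me' sm sm' ltnn.
  by have := s_pfactorM_lt a0 v1 pp' pp ca' ca lt; rewrite -me -me' sm sm' ltnn.
have [om sm] := hF m mF; have [_ _ vT [d dN ->]] := odd_preimage_split om sm.
by apply/allpairsP; exists (d, logn (pdiv m) m); rewrite !mem_iota add0n; split.
Qed.

End OddPreimages.

(** * Counting tools *)

Lemma size_le_sum_count (I : eqType) (r : seq I) (P : I -> pred nat) (F : seq nat) :
  (forall m, m \in F -> has (P^~ m) r) -> size F <= \sum_(i <- r) count (P i) F.
Proof.
move=> hF; rewrite -sum1_size.
have E i : count (P i) F = \sum_(m <- F) (P i m : nat).
  by rewrite -sum1_count big_mkcond; apply: eq_bigr => m _; case: (P i m).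
rewrite (eq_bigr _ (fun i _ => E i)).
rewrite exchange_big /= !big_seq; apply: leq_sum => m /hF.
elim: r {hF} => //= i r IH; rewrite big_cons.
by case: (P i m) => //= /IH; rewrite add0n.
Qed.

(** [k] distinct terms of a progression of modulus [M] span at least [k.-1 * M]. *)
Lemma size_progression (F : seq nat) K M H : uniq F -> 0 < M ->
  (forall x y, x \in F -> y \in F -> x <= y -> (M %| y - x) && (K * (y - x) <= H)) ->
  (size F).-1 * M * K <= H.
Proof.
move=> uF M0 hF; have [F1 | F1] := leqP (size F) 1.
  by move: F1; case: (size F) => [|[|]].
have exF : exists x, x \in F
  by case: F F1 {uF hF} => // x F; exists x; rewrite mem_head.
have [x0 x0F minx] := ex_minnP exF.
pose f y := (y - x0) %/ M.
have [y yF fy] : exists2 y, y \in F & (size F).-1 <= f y.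
  apply/hasP; rewrite -[has _ _]negbK -all_predC; apply/negP => /allP nF.
  have: size (map f F) <= size (iota 0 (size F).-1).
    apply: uniq_leq_size => [|z /mapP[y yF ->]].
      rewrite map_inj_in_uniq // => y y' yF yG e.
      have /andP[d _] := hF _ _ x0F yF (minx _ yF).
      have /andP[d' _] := hF _ _ x0F yG (minx _ yG).
      have: y - x0 = y' - x0 by rewrite -(divnK d) -(divnK d') -/(f y) e.
      by have := minx _ yF; have := minx _ yG; lia.
    by rewrite mem_iota add0n ltnNge; apply: nF.
  by rewrite size_map size_iota; case: (size F) F1 => // k _; rewrite /= ltnn.
have /andP[d le] := hF _ _ x0F yF (minx _ yF).
by apply: leq_trans le; rewrite mulnC leq_mul2l -(divnK d) leq_mul2r fy !orbT.
Qed.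

(** Dyadic blocks: each block [2 ^ l <= b < 2 ^ l.+1] contributes at most [X]. *)
Lemma sum_divn_le X L : \sum_(1 <= b < 2 ^ L) X %/ b <= X * L.
Proof.
elim: L => [|L IH]; first by rewrite big_geq.
have l0 : 0 < 2 ^ L by rewrite expn_gt0.
rewrite (big_cat_nat l0) /=; last by rewrite leq_exp2l.
rewrite mulnSr; apply: leq_add => //.
apply: (@leq_trans (\sum_(2 ^ L <= b < 2 ^ L.+1) X %/ 2 ^ L)).
  rewrite big_nat [leqRHS]big_nat.
  by apply: leq_sum => b /andP[lb _]; apply: leq_div2l.
rewrite sum_nat_const_nat expnS mul2n -addnn addnK mulnC; exact: leq_divM.
Qed.

(** * Even preimages with a given unitary divisor *)

Lemma s_coprimeM a b : 0 < a -> 0 < b -> coprime a b ->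
  s (a * b) = s a * b + sigma a * s b.
Proof.
move=> a0 b0 cab; apply/eqP; rewrite -(eqn_add2l (a * b)) -sigmaE ?muln_gt0 ?a0 //.
rewrite sigmaM // (sigmaE b0) (sigmaE a0); apply/eqP; ring.
Qed.

Lemma even_leq_s m : 0 < m -> ~~ odd m -> m <= 2 * s m.
Proof.
move=> m0 em; have e : m = m./2 * 2 by rewrite muln2 halfK (negPf em) subn0.
have h0 : 0 < m./2 by move: m0; rewrite {1}e muln_gt0 => /andP[].
rewrite {1}e mulnC leq_mul2l /=; apply: leq_dvd_s.
  by rewrite [m in _ %| m]e dvdn_mulr.
by rewrite [m in _ < m]e muln2 -addnn -ltn_subLR // subnn.
Qed.

(** A proper divisor [d] of [c] is [c / e] with [e > 1], so that
    [K * d <= D * e * d = D * c]; there are at most [tau c] of them. *)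
Lemma leq_mul_s K D c : 0 < c -> (forall e, e %| c -> 1 < e -> K <= D * e) ->
  K * s c <= tau c * (D * c).
Proof.
move=> c0 hc; rewrite /s big_distrr /= /tau -sum1_size big_distrl /= big_mkcond.
rewrite !big_seq; apply: leq_sum => d; rewrite -dvdn_divisors // => dc.
rewrite mul1n; case: ifP => // dnc; rewrite -[c in D * c](divnK dc) mulnA leq_mul2r.
rewrite hc ?orbT ?dvdn_div //.
have d0 : 0 < d by apply: dvdn_gt0 dc.
by rewrite ltn_divRL // mul1n ltn_neqAle dnc dvdn_leq.
Qed.

Lemma dvdn_quotient_gt0 d m : 0 < m -> d %| m -> 0 < m %/ d.
Proof. by move=> m0 dm; rewrite divn_gt0 ?(dvdn_gt0 m0 dm) // dvdn_leq. Qed.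

(** A unitary divisor [D] of [m] such that the prime factors of [m] it leaves out
    are at least [K / D]. Testing all divisors [d > 1] of the cofactor, rather than
    the primes, is equivalent and is the form that bounds [s] of the cofactor. *)
Definition unitary_rough (D K m : nat) : bool :=
  [&& D %| m, coprime D (m %/ D) &
      all (fun d => (d == 1) || (K <= D * d)) (divisors (m %/ D))].

Definition smooth_part y m := m`_[pred q | q <= y].

Lemma smooth_part_id m : 0 < m -> smooth_part m m = m.
Proof.
move=> m0; apply: part_pnat_id; apply/pnatP => // q _ qm.
by rewrite inE dvdn_leq.
Qed.

Lemma smooth_part_le1 z m : z <= 1 -> 0 < m -> smooth_part z m = 1.
Proof.
move=> z1 m0; apply: part_p'nat; apply/pnatP => // q pq _.
by rewrite !inE -ltnNge (leq_ltn_trans z1) // prime_gt1.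
Qed.

(** When [z] is not prime, [logn z m] is [0] and the two parts agree. *)
Lemma smooth_partS z m : 0 < z ->
  smooth_part z m = smooth_part z.-1 m * z ^ logn z m.
Proof.
move=> z0; rewrite /smooth_part
  -(partnC [pred q | q <= z.-1] (part_gt0 [pred q | q <= z] m)).
rewrite partn_part => [|q]; last by rewrite !inE => /leq_trans; apply; apply: leq_pred.
congr (_ * _); rewrite -p_part -partnI; apply: eq_partn => q.
by rewrite !inE; apply/andP/eqP; lia.
Qed.

Lemma smooth_part_unitary y m (D := smooth_part y m) : 0 < m ->
  [/\ D %| m, coprime D (m %/ D), forall d, d %| m %/ D -> 1 < d -> y < d &
    1 < y -> ~~ odd m -> ~~ odd D].
Proof.
move=> m0; have D0 : 0 < D by apply: part_gt0.
have Dm : D %| m by apply: dvdn_part.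
have cE : m %/ D = m`_([pred q | q <= y]^').
  by rewrite -[X in X %/ _](partnC [pred q | q <= y] m0) mulKn.
have rough d : d %| m %/ D -> 1 < d -> y < d.
  rewrite cE => dc d1; have := pnatP _ (ltnW d1) (pnat_dvd dc (part_pnat _ m)).
  move=> /(_ _ (pdiv_prime d1) (pdiv_dvd d)); rewrite !inE -ltnNge => /leq_trans.
  by apply; apply: pdiv_leq; apply: ltnW.
split=> //; first by rewrite cE coprime_partC.
move=> y1 em; apply/negP => oD; have o2 : 2 %| m %/ D.
  by move: em; rewrite -{1}(divnK Dm) oddM oD andbT dvdn2.
by have := rough 2 o2 isT; rewrite ltnNge y1.
Qed.

Section EvenPreimages.


Variables (n N T : nat).
Hypotheses (n0 : 0 < n) (N1 : 1 < N) (leN : n <= N ^ 2) (Nle : N <= 2 * n ^ 2).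
Hypothesis taule : forall k, 0 < k -> k <= 2 * n ^ 2 -> tau k <= T.

Let T0 : 0 < T.
Proof.
by apply: leq_trans (taule (isT : 0 < 1) _); rewrite // muln_gt0 expn_gt0 n0.
Qed.

Lemma even_preimage_le m : 0 < m -> ~~ odd m -> s m = n -> m <= 2 * n ^ 2.
Proof.
move=> m0 em sm; apply: leq_trans (even_leq_s m0 em) _.
by rewrite sm leq_mul2l /= -mulnn leq_pmulr.
Qed.

(** Archimedean constraint. The equation
    [n = s (D * c) = s D * c + sigma D * s c] bounds [c] above by [n / s D], and
    below by [(n - sigma D * s c) / s D]. For even [D] the ratio [sigma D / s D] is at
    most [3], so two solutions [c <= c'] are at distance at most [3 * s c]. *)
Lemma preimage_cofactor_dist D K c c' : 0 < D -> ~~ odd D -> 0 < c -> 0 < c' ->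
  coprime D c -> coprime D c' -> (forall d, d %| c -> 1 < d -> K <= D * d) ->
  s (D * c) = n -> s (D * c') = n -> K * (c' - c) <= 6 * T * n.
Proof.
move=> D0 eD c0 c0' cc cc' hc e e'; have m0 : 0 < D * c by rewrite muln_gt0 D0.
have em : ~~ odd (D * c) by rewrite oddM (negPf eD).
have le3 : c' - c <= 3 * s c.
  have sD0 : 0 < s D by have := even_leq_s D0 eD; case: (s D) => //; lia.
  rewrite -(leq_pmul2l sD0) mulnBr leq_subLR.
  apply: (@leq_trans n); first by rewrite -e' s_coprimeM // leq_addr.
  rewrite -e s_coprimeM // leq_add2l mulnA leq_mul2r sigmaE //.
  by have := even_leq_s D0 eD; lia.
apply: leq_trans (leq_mul (leqnn K) le3) _; rewrite mulnCA.
apply: leq_trans (leq_mul (leqnn 3) (leq_mul_s c0 hc)) _.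
have tc : tau c <= T.
  apply: taule => //; apply: leq_trans (even_preimage_le m0 em e).
  by rewrite leq_pmull.
have := leq_mul tc (even_leq_s m0 em); rewrite e; lia.
Qed.

(** Congruence constraint. A divisor [a] of [D] divides [m], and [sigma D] divides
    [sigma m = m + n]; a common divisor of [a] and [sigma D] therefore divides [n]. *)
Lemma preimage_congruence D a m : 0 < m -> D %| m -> coprime D (m %/ D) ->
  s m = n -> a %| D ->
  [/\ a %| m, sigma D %| m + n & gcdn a (sigma D) %| gcdn a n].
Proof.
move=> m0 Dm cD sm aD; have am := dvdn_trans aD Dm.
have D0 := dvdn_gt0 m0 Dm.
have sD : sigma D %| m + n.
  rewrite -sm -sigmaE // -[X in _ %| sigma X](divnK Dm) mulnC sigmaM ?dvdn_mulr //.
  by rewrite divn_gt0 // dvdn_leq.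
split=> //; rewrite dvdn_gcd dvdn_gcdl /=.
have := dvdn_trans (dvdn_gcdr a (sigma D)) sD.
by rewrite dvdn_addr // (dvdn_trans (dvdn_gcdl _ _)).
Qed.

(** The two constraints together: the preimages with a common unitary divisor [D]
    lie in one class modulo [lcmn a (sigma D) >= a * D / gcdn a n] and in an interval
    of length at most [6 * T * n * D / (N * p)]. *)
Lemma size_unitary_rough (F : seq nat) D a p : uniq F -> ~~ odd D -> a %| D ->
  0 < p -> a * p <= N ->
  (forall m, m \in F -> [&& 0 < m, s m == n & unitary_rough D (N * p) m]) ->
  size F * (a * p) <= 7 * T * N * gcdn a n.
Proof.
move=> uF eD aD p0 apN hF.
case: (posnP (size F)) => [-> // | F0].
have [m mF] : exists m, m \in F
  by case: F F0 {uF hF} => // x F; exists x; rewrite mem_head.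
have D0 : 0 < D by have /and3P[m0 _ /and3P[Dm _ _]] := hF m mF; apply: dvdn_gt0 Dm.
have a0 : 0 < a by apply: dvdn_gt0 aD.
have g0 : 0 < gcdn a n by rewrite gcdn_gt0 a0.
set M := lcmn a (sigma D).
have M0 : 0 < M by rewrite lcmn_gt0 a0 sigma_gt0.
have Mg : a * D <= M * gcdn a n.
  have /and3P[m0 /eqP sm /and3P[Dm cD _]] := hF m mF.
  have [_ _ dg] := preimage_congruence m0 Dm cD sm aD.
  apply: leq_trans (_ : M * gcdn a (sigma D) <= _); last first.
    by rewrite leq_mul2l dvdn_leq ?orbT.
  by rewrite muln_lcm_gcd leq_mul2l sigmaE // leq_addr orbT.
have key : (size F).-1 * M * (N * p) <= 6 * T * n * D.
  apply: size_progression => // x y xF yF xy.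
  have /and3P[x0 /eqP sx /and3P[Dx cx rx]] := hF x xF.
  have /and3P[y0 /eqP sy /and3P[Dy cy _]] := hF y yF.
  have [ax sDx _] := preimage_congruence x0 Dx cx sx aD.
  have [ay sDy _] := preimage_congruence y0 Dy cy sy aD.
  rewrite dvdn_lcm dvdn_sub //= -[in sigma D %| _](subnDr n) dvdn_sub //=.
  have -> : y - x = (y %/ D - x %/ D) * D by rewrite mulnBl !divnK.
  rewrite mulnA leq_mul2r; apply/orP; right.
  apply: (@preimage_cofactor_dist D) => //; rewrite ?dvdn_quotient_gt0 //; last 2 first.
  - by rewrite mulnC divnK.
  - by rewrite mulnC divnK.
  move=> d dx d1; move/allP: rx => /(_ d).
  rewrite -dvdn_divisors ?dvdn_quotient_gt0 // => /(_ dx).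
  by rewrite gtn_eqF.
have key2 : (size F).-1 * (a * p) <= 6 * T * N * gcdn a n.
  have ND0 : 0 < N * D by rewrite muln_gt0 D0 ltnW.
  rewrite -(leq_pmul2r ND0).
  apply: leq_trans (_ : (size F).-1 * M * (N * p) * gcdn a n <= _).
    have := leq_mul (leqnn ((size F).-1 * (N * p))) Mg; lia.
  apply: leq_trans (leq_mul key (leqnn _)) _.
  have := leq_mul (leqnn (6 * T * D * gcdn a n)) leN; rewrite -mulnn; lia.
(* The progression bound misses one preimage, which costs [a * p <= N]. *)
have le1 : a * p <= T * N * gcdn a n.
  by apply: leq_trans apN _; rewrite -mulnA mulnCA leq_pmulr // muln_gt0 T0.
rewrite -(prednK F0) mulSn; lia.
Qed.

(** If [m <= N], take [D = a = m]. Otherwise multiply the prime power components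
    of [m] in increasing order of the primes until the product exceeds [N], say at
    the prime [z], and let [a] be the product before [z]. If [a * z > N], the primes
    missing from [D = a] are at least [z > N / a]; this case has [p = 1] and [e = 0].
    Otherwise [z] enters through its full power: [D = a * z ^ v > N], the missing
    primes exceed [z], and [p = z], [e = v]. *)
Lemma exists_unitary_rough m : 0 < m -> ~~ odd m -> m <= 2 * n ^ 2 ->
  exists a p e, [/\ 0 < a, 0 < p, a * p <= N, e < T &
    ~~ odd (a * p ^ e) && unitary_rough (a * p ^ e) (N * p) m].
Proof.
move=> m0 em mle.
have U D K : D %| m -> coprime D (m %/ D) ->
    (forall d, d %| m %/ D -> 1 < d -> K <= D * d) -> unitary_rough D K m.
  move=> Dm cD hd; rewrite /unitary_rough Dm cD /=; apply/allP => d.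
  have c0 := dvdn_quotient_gt0 m0 Dm.
  rewrite -dvdn_divisors // => dc; have d0 := dvdn_gt0 c0 dc.
  by have [d1 | d1] := leqP d 1; [rewrite eqn_leq d1 d0 | rewrite hd ?orbT].
have [mN | Nm] := leqP m N.
  exists m, 1, 0; rewrite muln1 em; split=> //.
  apply: U; rewrite ?divnn ?m0 ?coprimen1 //.
  by move=> d; rewrite dvdn1 => /eqP ->.
have exz : exists z, N < smooth_part z m by exists m; rewrite smooth_part_id.
have [z Nz minz] := ex_minnP exz.
have aN : smooth_part z.-1 m <= N.
  have [z0 | z0] := posnP z; first by rewrite z0 smooth_part_le1 // ltnW.
  by rewrite leqNgt; apply/negP => /minz; rewrite leqNgt prednK ?leqnn.
have z0 : 0 < z by case: (posnP z) Nz => // ->; rewrite smooth_part_le1 // ltnNge ltnW.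
move: Nz; rewrite smooth_partS //; set a := smooth_part z.-1 m in aN *.
set v := logn z m => Nz.
have a0 : 0 < a := part_gt0 _ m.
have v0 : 0 < v by move: Nz aN; case: (v) => //; rewrite muln1 ltnNge => /negPf ->.
have pz : prime z by move: v0; rewrite logn_gt0 mem_primes => /andP[].
have [am ca ra ea] := smooth_part_unitary z.-1 m0.
have [Dm cD rD eD] := smooth_part_unitary z m0.
rewrite smooth_partS // -/a -/v in Dm cD rD eD; rewrite -/a in am ca ra ea.
have [azN | Naz] := leqP (a * z) N.
  exists a, z, v; split=> //; last first.
    apply/andP; split; first by apply: eD => //; exact: prime_gt1.
    by apply: U => // d dc d1; rewrite leq_mul // ltnW // rD.
  rewrite -(tau_pfactor v pz); apply: taule; first by rewrite expn_gt0 z0.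
  by apply: leq_trans mle; apply: dvdn_leq => //; exact: pfactor_dvdnn.
(* [z > 2], since [z = 2] would give [a = 1] and [a * z <= N]; so [2] divides [a]. *)
have z2 : 1 < z.-1.
  rewrite ltnNge; apply/negP => z2; have z2' : z = 2 by have := prime_gt1 pz; lia.
  by move: Naz; rewrite /a z2' smooth_part_le1 // mul1n ltnNge N1.
exists a, 1, 0; rewrite !muln1; split=> //; apply/andP; split; first exact: ea.
apply: U => // d dc d1.
apply: leq_trans (ltnW Naz) _; rewrite leq_mul2l; apply/orP; right.
by have := ra d dc d1; rewrite prednK.
Qed.

(** Summation over the triples [(a, p, e)] of the bound
    [7 * T * N * gcdn a n / (a * p)]. Writing [a = g * b] with [g = gcdn a n] turns
    the weight [gcdn a n / a] into [1 / b]: one factor [T] counts the divisors [g] of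
    [n], one the exponents [e], and the harmonic sums over [b] and [p] cost one each. *)
Lemma size_even_preimages (F : seq nat) : uniq F ->
  (forall m, m \in F -> [/\ 0 < m, ~~ odd m & s m = n]) ->
  size F <= 7 * T ^ 5 * N.
Proof.
move=> uF hF.
pose r := [seq (gb, pe) | gb <- [seq (g, b) | g <- divisors n, b <- index_iota 1 N.+1],
                        pe <- [seq (p, e) | p <- index_iota 1 N.+1, e <- iota 0 T]].
pose P (i : (nat * nat) * (nat * nat)) m := let: (g, b, (p, e)) := i in
  [&& gcdn (g * b) n == g, g * b * p <= N, ~~ odd (g * b * p ^ e) &
      unitary_rough (g * b * p ^ e) (N * p) m].
pose X := 7 * T * N.
have cover m : m \in F -> has (P^~ m) r.
  move=> /hF[m0 em sm].
  have [a [p [e [a0 p0 apN eT /andP[eD rD]]]]] :=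
    exists_unitary_rough m0 em (even_preimage_le m0 em sm).
  have g0 : 0 < gcdn a n by rewrite gcdn_gt0 a0.
  have ae : gcdn a n * (a %/ gcdn a n) = a by rewrite mulnC divnK // dvdn_gcdl.
  have aN : a <= N by apply: leq_trans apN; rewrite leq_pmulr.
  have pN : p <= N by apply: leq_trans apN; rewrite leq_pmull.
  apply/hasP; exists (gcdn a n, a %/ gcdn a n, (p, e)); last first.
    by rewrite /P ae eqxx apN eD rD.
  apply/allpairsP; exists ((gcdn a n, a %/ gcdn a n), (p, e)); split=> //.
    apply/allpairsP; exists (gcdn a n, a %/ gcdn a n); split=> //=.
      by rewrite -dvdn_divisors ?dvdn_gcdr.
    rewrite mem_index_iota ltnS dvdn_quotient_gt0 ?dvdn_gcdl //.
    by apply: leq_trans aN; apply: leq_div.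
  apply/allpairsP; exists (p, e); split=> //=; first by rewrite mem_index_iota p0 ltnS.
  by rewrite mem_iota add0n.
have bnd i : i \in r -> count (P i) F <= X %/ i.1.2 %/ i.2.1.
  case/allpairsP => -[[g b] [p e]] [/= /allpairsP[[g' b'] [/= gn bN [-> ->]]]].
  case/allpairsP => -[p' e'] [/= pN _ [-> ->]] -> /=.
  move: bN pN; rewrite !mem_index_iota => /andP[b0 _] /andP[p0 _].
  rewrite -divnMA leq_divRL ?muln_gt0 ?b0 // -size_filter.
  set G := seq.filter _ F.
  have g0 : 0 < g' by move: gn; rewrite -dvdn_divisors // => /(dvdn_gt0 n0).
  case: (posnP (size G)) => [-> // | G0].
  have [m] : exists m, m \in G by case: (G) G0 => // x F1; exists x; rewrite mem_head.
  rewrite mem_filter => /andP[/and4P[/eqP gE apN eD _] _].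
  rewrite -(leq_pmul2r g0).
  have -> : size G * (b' * p') * g' = size G * (g' * b' * p') by ring.
  rewrite -{2}gE; apply: (@size_unitary_rough G (g' * b' * p' ^ e')) => //.
  - by rewrite filter_uniq.
  - by rewrite dvdn_mulr.
  move=> k; rewrite mem_filter => /andP[/and4P[_ _ _ rk] /hF[k0 _ ->]].
  by rewrite k0 eqxx rk.
apply: leq_trans (size_le_sum_count cover) _.
apply: (@leq_trans (\sum_(i <- r) X %/ i.1.2 %/ i.2.1)).
  by rewrite big_seq [leqRHS]big_seq; apply: leq_sum.
pose L := (trunc_log 2 N).+1.
(* [L] is the number of divisors of the largest power of [2] up to [N]. *)
have LT : L <= T.
  have p2 : prime 2 by [].
  have tN := trunc_logP (isT : 1 < 2) (ltnW N1).
  rewrite /L -(tau_pfactor _ p2); apply: taule; first by rewrite expn_gt0.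
  exact: leq_trans tN Nle.
have harm Y : \sum_(b <- index_iota 1 N.+1) Y %/ b <= Y * T.
  apply: leq_trans (_ : Y * L <= _); last by rewrite leq_mul2l LT orbT.
  apply: leq_trans (sum_divn_le Y L).
  rewrite [leqRHS](@big_cat_nat _ _ _ N.+1) //=; first exact: leq_addr.
  exact: trunc_log_ltn.
rewrite big_allpairs_dep big_allpairs_dep /=.
have inner Y : \sum_(pe <- [seq (p, e) | p <- index_iota 1 N.+1, e <- iota 0 T])
    Y %/ pe.1 <= Y * T * T.
  rewrite big_allpairs_dep /=.
  under eq_bigr => p _ do rewrite big_const_seq count_predT size_iota iter_addn_0.
  by rewrite -big_distrl /= leq_mul2r harm orbT.
apply: (@leq_trans (\sum_(g <- divisors n) X * T * T * T)).
  apply: leq_sum => g _.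
  apply: (@leq_trans (\sum_(b <- index_iota 1 N.+1) X %/ b * T * T)).
    by apply: leq_sum => b _; apply: inner.
  by rewrite -!big_distrl /= !leq_mul2r harm !orbT.
rewrite big_const_seq count_predT iter_addn_0.
have tn : tau n <= T.
  by apply: taule => //; rewrite -mulnn mulnA leq_pmull // muln_gt0.
apply: leq_trans (leq_mul (leqnn _) tn) _; rewrite /X.
by have -> : 7 * T * N * T * T * T * T = 7 * T ^ 5 * N by ring.
Qed.

End EvenPreimages.

(** * Assembling the bound *)

(** The cutoff for prefixes is [N = r + 1], with [r] the integer square root of [n],
    so that [1 < N] and [n <= N ^ 2]. *)
Lemma preimages_list n r T : 0 < n -> ~~ odd n -> 0 < r -> r ^ 2 <= n -> n < r.+1 ^ 2 ->
    (forall k, 0 < k -> k <= 2 * n ^ 2 -> tau k <= T) ->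
  exists F : seq nat, [/\ uniq F, forall m, (m \in F) = (0 < m) && (s m == n) &
    size F <= 18 * T ^ 5 * r].
Proof.
move=> n0 en r0 rn nr taule; have T0 : 0 < T.
  by apply: leq_trans (taule 1 isT _); rewrite // muln_gt0 expn_gt0 n0.
have nr' : n <= r.+1 ^ 2 := ltnW nr.
have rn2 : r.+1 <= 2 * n ^ 2.
  have := leq_mul n0 (leqnn n); have := leq_mul r0 (leqnn r); rewrite -mulnn in rn.
  rewrite -mulnn; lia.
pose F := [seq m <- iota 1 (2 * n ^ 2) | s m == n].
have uF : uniq F by apply: filter_uniq; apply: iota_uniq.
have memF m : (m \in F) = (0 < m) && (s m == n).
  rewrite mem_filter mem_iota add1n ltnS andbC; case: (posnP m) => //= m0.
  case: eqP => sm; rewrite ?andbF // andbT.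
  have [om | em] := boolP (odd m).
    have [mn _ _ _] := odd_preimage_split n0 en nr' taule om sm.
    by apply: leq_trans mn _; rewrite leq_pmull.
  exact: even_preimage_le em sm.
exists F; split=> //; rewrite -(count_predC odd F) -!size_filter.
have odds : size [seq m <- F | odd m] <= r.+2 * T.
  apply: (size_odd_preimages n0 en nr' taule); first by rewrite filter_uniq.
  by move=> m; rewrite mem_filter memF => /and3P[om _ /eqP].
have evens : size [seq m <- F | predC odd m] <= 7 * T ^ 5 * r.+1.
  apply: (size_even_preimages n0 _ nr' rn2 taule) => //; first exact: filter_uniq.
  by move=> m; rewrite mem_filter memF => /and3P[/= em m0 /eqP].
have T5 : T <= T ^ 5 by rewrite -{1}(expn1 T) leq_pexp2l.
apply: leq_trans (leq_add odds evens) _.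
apply: (@leq_trans (4 * r * T ^ 5 + 7 * T ^ 5 * (2 * r))); last by apply: eq_leq; ring.
by apply: leq_add; apply: leq_mul => //; lia.
Qed.

Local Open Scope ring_scope.

Theorem corollary2p3 (R : realType) (eps : R) (heps : 0 < eps) :
  exists C : R, 0 < C /\
    forall n : nat, (0 < n)%N -> ~~ odd n ->
      finite_set (s_fiber n) /\
      (#|` fset_set (s_fiber n)|%fset)%:R <= C * (n%:R `^ (2^-1 + eps)).
Proof.
(* The divisor bound with exponent [5 * j] gives [(T ^ 5) ^ j <= 2 * K * n ^ 2],
   so [T ^ 5] is of order [n `^ (2 / j)]. *)
have [j j0 jeps] : exists2 j, (0 < j)%N & 2 / j%:R <= eps.
  have hj := archi_boundP (ltW (divr_gt0 (ltr0n R 2) heps)).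
  exists (Num.bound (2 / eps)).+1 => //.
  rewrite ler_pdivrMr ?ltr0n // mulrC -ler_pdivrMr //; apply/ltW/(lt_le_trans hj).
  by rewrite ler_nat.
have [K K0 tauK] := tau_bound (5 * j).
have K20 : 0 < (2 * K)%:R :> R by rewrite ltr0n muln_gt0.
exists (18%:R * (2 * K)%:R `^ j%:R^-1); split.
  by rewrite mulr_gt0 ?ltr0n // powR_gt0.
move=> n n0 en.
have n1 : 1 <= n%:R :> R by rewrite ler1n.
pose T := \max_(1 <= k < (2 * n ^ 2).+1) tau k.
have taule k : (0 < k)%N -> (k <= 2 * n ^ 2)%N -> (tau k <= T)%N.
  by move=> k0 kn; apply: (@leq_bigmax_seq _ _ xpredT); rewrite ?mem_index_iota ?k0.
have Tle : (T ^ (5 * j) <= 2 * K * n ^ 2)%N.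
  rewrite /T big_nat; elim/big_ind: _ => [|x y xle yle|k /andP[k0 kn]].
  - by rewrite exp0n // muln_gt0 j0.
  - by case: (leqP x y).
  apply: leq_trans (tauK k k0) _.
  have -> : (2 * K * n ^ 2 = K * (2 * n ^ 2))%N by ring.
  by rewrite leq_mul2l -ltnS kn orbT.
have exr : exists r, (r ^ 2 <= n)%N by exists 0%N.
have ubr r : (r ^ 2 <= n)%N -> (r <= n)%N.
  by apply: leq_trans; rewrite -mulnn; case: r => // r; rewrite leq_pmulr.
have [r rn maxr] := ex_maxnP exr ubr.
have r0 : (0 < r)%N by apply: maxr; rewrite exp1n.
have nr : (n < r.+1 ^ 2)%N by rewrite ltnNge; apply/negP => /maxr; rewrite ltnn.
have [F [uF memF sF]] := preimages_list n0 en r0 rn nr taule.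
have fibE : s_fiber n = [set` F]%classic.
  apply/seteqP; split=> m; rewrite /= memF; last by case/andP=> m0 /eqP.
  by case=> -> ->; rewrite eqxx.
split; first by rewrite fibE; exact: finite_seq.
apply: (@le_trans _ _ (size F)%:R).
  rewrite ler_nat; apply: uniq_leq_size => [|m]; first exact: fset_uniq.
  by rewrite in_fset_set fibE ?inE //; exact: finite_seq.
apply: (@le_trans _ _ (18%:R * (T ^ 5)%:R * r%:R)); first by rewrite -!natrM ler_nat.
have rle : r%:R <= n%:R `^ 2^-1 :> R.
  rewrite powR12_sqrt ?ler0n // -(ler_sqr) ?nnegrE ?ler0n ?sqrtr_ge0 //.
  by rewrite sqr_sqrtr ?ler0n // -natrX ler_nat.
have Tpow : (T ^ 5)%:R <= (2 * K)%:R `^ j%:R^-1 * n%:R `^ eps :> R.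
  have -> : (T ^ 5)%:R = ((T ^ (5 * j))%:R : R) `^ j%:R^-1.
    rewrite expnM (natrX _ (T ^ 5)%N j) -powR_mulrn ?ler0n //.
    rewrite -powRrM mulfV ?powRr1 ?ler0n //.
    by rewrite pnatr_eq0 -lt0n.
  apply: (@le_trans _ _ ((2 * K * n ^ 2)%:R `^ j%:R^-1)).
    by rewrite ge0_ler_powR ?invr_ge0 ?nnegrE ?ler0n // ler_nat.
  rewrite natrM powRM ?ler0n // ler_wpM2l ?powR_ge0 //.
  rewrite natrX -powR_mulrn ?ler0n // -powRrM; exact: ler_powR.
rewrite powRD; last by rewrite pnatr_eq0 -lt0n n0 implybT.
rewrite -!mulrA ler_wpM2l ?ler0n // [_ `^ 2^-1 * _]mulrC mulrA.
by apply: ler_pM; rewrite ?ler0n.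
Qed.
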